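(* Consider the saturated microgrid model and the notion of feasibility of a control for a disturbance realization defined in the context, with non-negative droop gains $\chi_{\mathrm t},\chi_{\mathrm s},\chi_{\mathrm r}$. For any initial conditions $x_{\mathrm s,0}\in[x^{\min},x^{\max}]$, $\delta_{\mathrm t,0}\in\{0,1\}^T$, the set of robustly feasible controls $(\boldsymbol\delta_{\mathrm t},\mathbf u)$, i.e. the set of admissible controls which are feasible for every disturbance realization $\mathbf w\in[\mathbf w^{\min},\mathbf w^{\max}]$, equals the set of admissible controls which are feasible for the two disturbance realizations $\mathbf w=\mathbf w^{\min}$ and $\mathbf w=\mathbf w^{\max}$.
   Context: Conventions. All comparisons, minima, maxima between vectors or matrices are elementwise; $[a,b]$ denotes the box $\{z: a\le z\le b\}$; $\mathbf 1^{\mathsf T}z=\sum_i z_i$. For $\delta\in\{0,1\}$, $z\in\mathbb R$: $\delta\wedge z=z$ if $\delta=1$ and $0$ if $\delta=0$ (elementwise for vectors). For $a\le b$: $\mathrm{sat}(a,z,b)=a$ if $z<a$, $=z$ if $z\in[a,b]$, $=b$ if $z>b$ (elementwise for vectors). Data. $T,S,R,D$ are the numbers of conventional units, storage units, renewable units and loads; $N_p\in\mathbb N$ is the prediction horizon, $\mathrm T_{\mathrm s}>0$ the sampling time, $k$ a fixed time instant. Droop gains $\chi_{\mathrm t}\in\mathbb R_{\ge0}^T$, $\chi_{\mathrm s}\in\mathbb R_{\ge0}^S$, $\chi_{\mathrm r}\in\mathbb R_{\ge0}^R$ (products such as $\chi_{\mathrm t}\rho$ with a scalar $\rho$ are scalar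 multiples). Power limits $p_{\mathrm t}^{\min}\in\mathbb R_{\ge0}^T$, $p_{\mathrm s}^{\min}\in\mathbb R_{<0}^S$, $p_{\mathrm r}^{\min}\in\mathbb R_{\ge0}^R$, $p_{\mathrm t}^{\max}\in\mathbb R_{>0}^T$, $p_{\mathrm s}^{\max}\in\mathbb R_{>0}^S$ with $p_{\mathrm t}^{\min}\le p_{\mathrm t}^{\max}$. Energy limits $x^{\min}\in\mathbb R_{\ge0}^S$, $x^{\max}\in\mathbb R_{>0}^S$, $x^{\min}\le x^{\max}$. Set-point limits $u^{\min}\le u^{\max}$ in $\mathbb R^{T+S+R}$. Variables, for $j=1,\dots,N_p$. Set-points $u(k+j)=(u_{\mathrm t},u_{\mathrm s},u_{\mathrm r})(k+j)\in\mathbb R^{T}\times\mathbb R^S\times\mathbb R^R$; switch statuses $\delta_{\mathrm t}(k+j)\in\{0,1\}^T$; disturbances $w(k+j)=(w_{\mathrm r},w_{\mathrm d})(k+j)$ with available renewable infeed $w_{\mathrm r}\in\mathbb R_{\ge0}^R$ and load $w_{\mathrm d}\in\mathbb R_{\le0}^D$; unit powers $p(k+j)=(p_{\mathrm t},p_{\mathrm s},p_{\mathrm r})(k+j)$; stored energies $x(k+j)\in\mathbb R^S$; auxiliary free scalar $\rho(k+j)\in\mathbb R$. Bold symbols $\boldsymbol\delta_{\mathrm t},\mathbf u,\mathbf w$ denote the matrices whose columns are the values at $k+1,\dots,k+N_p$; $\mathbf w^{\min}\le\mathbf w^{\max}$ are given disturbance bounds (also of this sign type), and the renewable bounds satisfy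 $w_{\mathrm r}^{\min}(k+j)\ge p_{\mathrm r}^{\min}$ so that the saturation below is well-defined. Saturated model, for $j=1,\dots,N_p$: $$\begin{aligned} 0&=\mathbf 1^{\mathsf T}p(k+j)+\mathbf 1^{\mathsf T}w_{\mathrm d}(k+j),\\ p_{\mathrm r}(k+j)&=\mathrm{sat}(p_{\mathrm r}^{\min},\,u_{\mathrm r}(k+j)+\chi_{\mathrm r}\rho(k+j),\,w_{\mathrm r}(k+j)),\\ p_{\mathrm t}(k+j)&=\delta_{\mathrm t}(k+j)\wedge\mathrm{sat}(p_{\mathrm t}^{\min},\,u_{\mathrm t}(k+j)+\chi_{\mathrm t}\rho(k+j),\,p_{\mathrm t}^{\max}),\\ \bar p_{\mathrm s}^{\min}(k+j)&=\max(p_{\mathrm s}^{\min},(x(k+j-1)-x^{\max})/\mathrm T_{\mathrm s}),\\ \bar p_{\mathrm s}^{\max}(k+j)&=\min(p_{\mathrm s}^{\max},(x(k+j-1)-x^{\min})/\mathrm T_{\mathrm s}),\\ p_{\mathrm s}(k+j)&=\mathrm{sat}(\bar p_{\mathrm s}^{\min}(k+j),\,u_{\mathrm s}(k+j)+\chi_{\mathrm s}\rho(k+j),\,\bar p_{\mathrm s}^{\max}(k+j)),\\ x(k+j)&=x(k+j-1)-\mathrm T_{\mathrm s}\,p_{\mathrm s}(k+j), \end{aligned}$$ with initial conditions $x(k)=x_{\mathrm s,0}$, $\delta_{\mathrm t}(k)=\delta_{\mathrm t,0}$. Feasibility. A control $(\boldsymbol\delta_{\mathrm t},\mathbf u)$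 is admissible if $\boldsymbol\delta_{\mathrm t}\in\{0,1\}^{T\times N_p}$ and every column of $\mathbf u$ lies in $[u^{\min},u^{\max}]$. An admissible control is feasible for a disturbance realization $\mathbf w$ if there exist $p(k+j),x(k+j),\rho(k+j)$, $j=1,\dots,N_p$, satisfying the saturated model with the given initial conditions. *)

(* Defs.v *)
From HB Require Import structures.
From mathcomp Require Import all_boot all_order all_algebra.
From mathcomp Require Import all_classical all_reals.

Set Implicit Arguments.
Unset Strict Implicit.
Unset Printing Implicit Defensive.

Import Order.TTheory GRing.Theory Num.Theory.
Local Open Scope ring_scope.

(* The model is time-invariant, so the fixed instant k is left implicit: in a
   matrix with Np columns, column j : 'I_Np holds the value at time k + j + 1;
   in a matrix with 1 + Np columns, column j holds the value at time k + j. *)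

Section Elementwise.
Context {R : realType} {m n : nat}.
Implicit Types A B Z : 'M[R]_(m, n).

Definition lemx A B : Prop := forall i j, A i j <= B i j.
Definition ltmx A B : Prop := forall i j, A i j < B i j.
Definition in_box A B Z : Prop := lemx A Z /\ lemx Z B.

(* Meant for a <= b only; if a > b the value is a or b. *)
Definition sat (a z b : R) : R :=
  if z < a then a else if z <= b then z else b.
Definition satmx A Z B : 'M[R]_(m, n) :=
  \matrix_(i, j) sat (A i j) (Z i j) (B i j).

Definition andmx (d : 'M[bool]_(m, n)) Z : 'M[R]_(m, n) :=
  \matrix_(i, j) (if d i j then Z i j else 0).

Definition maxmx A B : 'M[R]_(m, n) := map2_mx Num.max A B.
Definition minmx A B : 'M[R]_(m, n) := map2_mx Num.min A B.
End Elementwise.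

Definition sumv {R : realType} {n : nat} (z : 'cV[R]_n) : R := \sum_i z i 0.

Record microgrid (R : realType) (nT nS nR : nat) := Microgrid {
  Ts : R;
  chi_t : 'cV[R]_nT;
  chi_s : 'cV[R]_nS;
  chi_r : 'cV[R]_nR;
  pt_min : 'cV[R]_nT;
  pt_max : 'cV[R]_nT;
  ps_min : 'cV[R]_nS;
  ps_max : 'cV[R]_nS;
  pr_min : 'cV[R]_nR;
  x_min : 'cV[R]_nS;
  x_max : 'cV[R]_nS;
  u_min : 'cV[R]_(nT + nS + nR);
  u_max : 'cV[R]_(nT + nS + nR);
  Ts_gt0 : 0 < Ts;
  chi_t_ge0 : lemx 0 chi_t;
  chi_s_ge0 : lemx 0 chi_s;
  chi_r_ge0 : lemx 0 chi_r;
  pt_min_ge0 : lemx 0 pt_min;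
  pt_max_gt0 : ltmx 0 pt_max;
  pt_min_le_max : lemx pt_min pt_max;
  ps_min_lt0 : ltmx ps_min 0;
  ps_max_gt0 : ltmx 0 ps_max;
  pr_min_ge0 : lemx 0 pr_min;
  x_min_ge0 : lemx 0 x_min;
  x_max_gt0 : ltmx 0 x_max;
  x_min_le_max : lemx x_min x_max;
  u_min_le_max : lemx u_min u_max
}.

(* Stacked vectors and matrices: (t, s, r) for set-points and unit powers,
   (r, d) for disturbances. *)
Section Blocks.
Context {R : realType} {nT nS nR nD n : nat}.
Definition t_part (v : 'M[R]_(nT + nS + nR, n)) : 'M[R]_(nT, n) :=
  usubmx (usubmx v).
Definition s_part (v : 'M[R]_(nT + nS + nR, n)) : 'M[R]_(nS, n) :=
  dsubmx (usubmx v).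
Definition r_part (v : 'M[R]_(nT + nS + nR, n)) : 'M[R]_(nR, n) := dsubmx v.
Definition w_renewable (w : 'M[R]_(nR + nD, n)) : 'M[R]_(nR, n) := usubmx w.
Definition w_load (w : 'M[R]_(nR + nD, n)) : 'M[R]_(nD, n) := dsubmx w.

Definition disturbance_sign (w : 'M[R]_(nR + nD, n)) : Prop :=
  lemx 0 (w_renewable w) /\ lemx (w_load w) 0.
End Blocks.

Section Model.
Context {R : realType} {nT nS nR nD Np : nat}.
Variable G : microgrid R nT nS nR.

Definition ps_bar_min (xprev : 'cV[R]_nS) : 'cV[R]_nS :=
  maxmx (ps_min G) ((Ts G)^-1 *: (xprev - x_max G)).
Definition ps_bar_max (xprev : 'cV[R]_nS) : 'cV[R]_nS :=
  minmx (ps_max G) ((Ts G)^-1 *: (xprev - x_min G)).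

Definition saturated_step (dt : 'cV[bool]_nT) (u : 'cV[R]_(nT + nS + nR))
    (w : 'cV[R]_(nR + nD)) (p : 'cV[R]_(nT + nS + nR))
    (xprev x : 'cV[R]_nS) (rho : R) : Prop :=
  [/\ 0 = sumv p + sumv (w_load w),
      r_part p = satmx (pr_min G) (r_part u + rho *: chi_r G) (w_renewable w),
      t_part p =
        andmx dt (satmx (pt_min G) (t_part u + rho *: chi_t G) (pt_max G)),
      s_part p =
        satmx (ps_bar_min xprev) (s_part u + rho *: chi_s G) (ps_bar_max xprev)
    & x = xprev - Ts G *: s_part p].

(* dt and x also carry the values at time k; the model constrains dt only from
   time k + 1 on. *)
Definition saturated_model (dt : 'M[bool]_(nT, 1 + Np))
    (u : 'M[R]_(nT + nS + nR, Np)) (w : 'M[R]_(nR + nD, Np))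
    (p : 'M[R]_(nT + nS + nR, Np)) (x : 'M[R]_(nS, 1 + Np))
    (rho : 'rV[R]_Np) : Prop :=
  forall j : 'I_Np,
    saturated_step (col (rshift 1 j) dt) (col j u) (col j w) (col j p)
      (col (widen_ord (leqnSn Np) j) x) (col (rshift 1 j) x) (rho 0 j).

Definition control : Type := 'M[bool]_(nT, Np) * 'M[R]_(nT + nS + nR, Np).

(* The switch statuses are {0,1}-valued by typing. *)
Definition admissible (c : control) : Prop :=
  forall j, in_box (u_min G) (u_max G) (col j c.2).

Definition feasible (x0 : 'cV[R]_nS) (dt0 : 'cV[bool]_nT) (c : control)
    (w : 'M[R]_(nR + nD, Np)) : Prop :=
  exists (p : 'M[R]_(nT + nS + nR, Np)) (x : 'M[R]_(nS, Np)) (rho : 'rV[R]_Np),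
    saturated_model (row_mx dt0 c.1) c.2 w p (row_mx x0 x) rho.

End Model.
Arguments control : clear implicits.

(* Main.v *)
Require Import Defs.
From HB Require Import structures.
From mathcomp Require Import all_boot all_order all_algebra.
From mathcomp Require Import all_classical all_reals.
From mathcomp Require Import lra topology normedtype.

Set Implicit Arguments.
Unset Strict Implicit.
Unset Printing Implicit Defensive.

Import Order.TTheory GRing.Theory Num.Theory.
Import numFieldNormedType.Exports.
Local Open Scope classical_set_scope.
Local Open Scope ring_scope.

(** Robust feasibility reduces to the two extreme realizations because the
    model is monotone.  The only unknown of a time step is the scalar [rho]:
    the unit powers and the next energy are functions of it, and it has to make
    the power surplus (the sum of all unit powers and loads, [surplus]) vanish.
    The surplus is nondecreasing in the disturbance, in the stored energy and,
    because the droop gains are nonnegative, in [rho] ([surplus_mono]).  The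
    next energy is nonincreasing in [rho] ([next_energy_anti]) and, for a fixed
    [rho], nondecreasing in the current energy ([next_energy_mono]): the
    saturation bounds of the storage power grow with slope at most [1 / Ts], so
    that extra stored energy is never more than used up within one step.

    Let [L] and [H] be energy trajectories for the lower and the upper
    disturbance bound, and let [w] lie in between.  A trajectory [X] for [w]
    with [L j <= X j <= H j] is built step by step ([step_sandwich]).  If [rl]
    and [rh] balance the steps of [L] and [H], then at [X j] and [w] the surplus
    is nonnegative at [rl] and nonpositive at [rh].  If [rh < rl], the
    intermediate value theorem gives a balancing [rho] between them, and the
    monotonicity of the next energy preserves the sandwich.  If [rl <= rh], the
    surplus vanishes at both ends; being a sum of nondecreasing terms, it can
    only do so if no storage power changes between [rl] and [rh], so [rl] serves
    on both sides.  The sandwich also keeps [X j] within the energy limits,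
    where the saturation bounds of the storage power are in the right order. *)

(** * Saturation of a scalar *)

Section Sat.
Context {R : realType}.
Implicit Types a b z d : R.

(** This form exposes continuity, which the piecewise definition of [sat]
    hides. *)
Lemma satE a z b : a <= b -> sat a z b = Num.max a (Num.min z b).
Proof.
rewrite /sat maxEle minEle => ab.
by case: (ltP z a); case: (leP z b); case: (leP a z); case: (leP a b); lra.
Qed.

Lemma sat_itv a z b : a <= b -> a <= sat a z b <= b.
Proof. by rewrite /sat; case: (ltP z a); case: (leP z b); lra. Qed.

Lemma sat_mono a z b a' z' b' : a <= b -> a' <= b' ->
  a <= a' -> z <= z' -> b <= b' -> sat a z b <= sat a' z' b'.
Proof.
rewrite /sat; case: (ltP z a); case: (leP z b); case: (ltP z' a');
  case: (leP z' b'); lra.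
Qed.

Lemma sat_shift a z b d : sat (a + d) (z + d) (b + d) = sat a z b + d.
Proof. by rewrite /sat ltrD2r lerD2r; case: ifP => // _; case: ifP. Qed.

Lemma continuous_sat_affine a b v c :
  a <= b -> continuous (fun r : R => sat a (v + r * c) b).
Proof.
move=> ab; have lin : continuous (fun r : R => v + r * c).
  move=> r; apply: cvgD; first exact: cvg_cst.
  exact: mulrr_continuous.
have -> : (fun r : R => sat a (v + r * c) b) =
    (fun=> a) \max ((fun r => v + r * c) \min (fun=> b)).
  by apply/funext => r; rewrite satE.
move=> r; apply: (continuous_max (T := R)); first exact: cvg_cst.
by apply: (continuous_min (T := R)); [exact: lin|exact: cvg_cst].
Qed.
End Sat.

(** * Elementwise order of matrices *)

Section ElementwiseOrder.
Context {R : realType}.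

Lemma lemx_trans m n (B A C : 'M[R]_(m, n)) :
  lemx A B -> lemx B C -> lemx A C.
Proof. by move=> AB BC i j; exact: le_trans (AB i j) (BC i j). Qed.

Lemma lemx_col m n (A B : 'M[R]_(m, n)) j :
  lemx A B -> lemx (col j A) (col j B).
Proof. by move=> AB i k; rewrite !mxE. Qed.

Lemma ler_sumv n (A B : 'cV[R]_n) : lemx A B -> sumv A <= sumv B.
Proof. by move=> AB; apply: ler_sum => i _. Qed.

(** The differences of the entries are nonnegative and their sum is at most
    zero.  This turns a flat total surplus into flat individual powers. *)
Lemma lemx_sumv_eq n (A B : 'cV[R]_n) :
  lemx A B -> sumv B <= sumv A -> A = B.
Proof.
move=> AB BA; have s0 : \sum_i (B i 0 - A i 0) = 0.
  rewrite sumrB; apply/eqP; rewrite subr_eq0 eq_le BA.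
  exact: ler_sumv.
have pos i : true -> 0 <= B i 0 - A i 0 by move=> _; rewrite subr_ge0.
apply/matrixP => i j; rewrite ord1.
by have /eqP := psumr_eq0P pos s0 (i := i) isT; rewrite subr_eq0 => /eqP.
Qed.

Lemma lemx_addZ n (c v : 'cV[R]_n) (r s : R) :
  lemx 0 c -> r <= s -> lemx (v + r *: c) (v + s *: c).
Proof.
move=> c0 rs i j; rewrite !mxE lerD2l ler_wpM2r//.
by have := c0 i j; rewrite mxE.
Qed.

Lemma lemx_satmx m n (A Z B A' Z' B' : 'M[R]_(m, n)) : lemx A B -> lemx A' B' ->
  lemx A A' -> lemx Z Z' -> lemx B B' -> lemx (satmx A Z B) (satmx A' Z' B').
Proof. by move=> *; move=> i j; rewrite !mxE; exact: sat_mono. Qed.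

Lemma lemx_andmx m n (d : 'M[bool]_(m, n)) (A B : 'M[R]_(m, n)) :
  lemx A B -> lemx (andmx d A) (andmx d B).
Proof. by move=> AB i j; rewrite !mxE; case: ifP. Qed.

Lemma sumv_parts nT nS nR (v : 'cV[R]_(nT + nS + nR)) :
  sumv v = sumv (t_part v) + sumv (s_part v) + sumv (r_part v).
Proof.
rewrite /sumv !big_split_ord /=; congr (_ + _ + _);
  by apply: eq_bigr => i _; rewrite !mxE.
Qed.

Lemma continuous_sumv n (f : R -> 'cV[R]_n) :
  (forall i, continuous (fun r => f r i 0)) -> continuous (fun r => sumv (f r)).
Proof.
move=> fc; apply: continuous_big => //; exact: add_continuous.
Qed.
End ElementwiseOrder.

(** * A single time step *)

Section Step.
Context {R : realType} {nT nS nR nD : nat}.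
Variables (G : microgrid R nT nS nR) (dt : 'cV[bool]_nT).
Variable u : 'cV[R]_(nT + nS + nR).
Implicit Types (w : 'cV[R]_(nR + nD)) (x : 'cV[R]_nS) (rho : R).

Definition t_power rho : 'cV[R]_nT :=
  andmx dt (satmx (pt_min G) (t_part u + rho *: chi_t G) (pt_max G)).
Definition s_power x rho : 'cV[R]_nS :=
  satmx (ps_bar_min G x) (s_part u + rho *: chi_s G) (ps_bar_max G x).
Definition r_power w rho : 'cV[R]_nR :=
  satmx (pr_min G) (r_part u + rho *: chi_r G) (w_renewable w).

Definition surplus w x rho : R :=
  sumv (t_power rho) + sumv (s_power x rho) + sumv (r_power w rho)
  + sumv (w_load w).
Definition next_energy x rho : 'cV[R]_nS := x - Ts G *: s_power x rho.

(** The model equations determine every power and the next energy from [rho],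
    which leaves the power balance as the only condition. *)
Lemma saturated_stepP w x x' rho :
  (exists p, saturated_step G dt u w p x x' rho) <->
  surplus w x rho = 0 /\ x' = next_energy x rho.
Proof.
split=> [[p [bal pr pt ps ->]]|[bal ->]].
  split; last by rewrite /next_energy /s_power -ps.
  by rewrite /surplus /t_power /s_power /r_power -pt -ps -pr -sumv_parts -bal.
exists (col_mx (col_mx (t_power rho) (s_power x rho)) (r_power w rho)).
have tE y z v : t_part (col_mx (col_mx y z) v) = y :> 'cV[R]_nT.
  by rewrite /t_part !col_mxKu.
have sE y z v : s_part (col_mx (col_mx y z) v) = z :> 'cV[R]_nS.
  by rewrite /s_part col_mxKu col_mxKd.
have rE y z v : r_part (col_mx (col_mx y z) v) = v :> 'cV[R]_nR.
  by rewrite /r_part col_mxKd.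
by split; rewrite ?sumv_parts ?tE ?sE ?rE.
Qed.

Lemma in_box_sandwich xl x xh :
  in_box (x_min G) (x_max G) xl -> in_box (x_min G) (x_max G) xh ->
  lemx xl x -> lemx x xh -> in_box (x_min G) (x_max G) x.
Proof.
by move=> [lb _] [_ ub] lx xh'; split; [exact: lemx_trans lx|exact: lemx_trans ub].
Qed.

(** Within the energy limits, power zero is always possible: it lies between
    the two bounds. *)
Lemma ps_bar_le x :
  in_box (x_min G) (x_max G) x -> lemx (ps_bar_min G x) (ps_bar_max G x).
Proof.
move=> [xlo xhi] i j; rewrite !mxE; apply: (@le_trans _ _ 0).
  rewrite ge_max pmulr_rle0 ?invr_gt0 ?Ts_gt0// subr_le0 xhi andbT.
  by have := ps_min_lt0 G i j; rewrite mxE => /ltW.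
rewrite le_min pmulr_rge0 ?invr_gt0 ?Ts_gt0// subr_ge0 xlo andbT.
by have := ps_max_gt0 G i j; rewrite mxE => /ltW.
Qed.

Lemma ps_bar_mono x x' : lemx x x' ->
  lemx (ps_bar_min G x) (ps_bar_min G x') /\
  lemx (ps_bar_max G x) (ps_bar_max G x').
Proof.
move=> xx'; split=> i j; rewrite !mxE; [apply: le_max2|apply: le_min2] => //;
  by rewrite ler_pM2l ?invr_gt0 ?Ts_gt0// lerD2r.
Qed.

Lemma t_power_mono rho rho' : rho <= rho' -> lemx (t_power rho) (t_power rho').
Proof.
move=> rr; apply/lemx_andmx/lemx_satmx => //; try exact: pt_min_le_max.
exact/lemx_addZ/rr/chi_t_ge0.
Qed.

Lemma s_power_mono x x' rho rho' :
  in_box (x_min G) (x_max G) x -> in_box (x_min G) (x_max G) x' ->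
  lemx x x' -> rho <= rho' -> lemx (s_power x rho) (s_power x' rho').
Proof.
move=> bx bx' /ps_bar_mono[lo hi] rr.
apply: lemx_satmx => //; try exact: ps_bar_le.
exact/lemx_addZ/rr/chi_s_ge0.
Qed.

Lemma r_power_mono w w' rho rho' : lemx (pr_min G) (w_renewable w) ->
  lemx w w' -> rho <= rho' -> lemx (r_power w rho) (r_power w' rho').
Proof.
move=> pw ww' rr.
have wr : lemx (w_renewable w) (w_renewable w') by move=> i j; rewrite !mxE.
apply: lemx_satmx => //; first exact: lemx_trans wr.
exact/lemx_addZ/rr/chi_r_ge0.
Qed.

Lemma surplus_mono w w' x x' rho rho' : lemx (pr_min G) (w_renewable w) ->
  in_box (x_min G) (x_max G) x -> in_box (x_min G) (x_max G) x' ->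
  lemx w w' -> lemx x x' -> rho <= rho' ->
  surplus w x rho <= surplus w' x' rho'.
Proof.
move=> pw bx bx' ww' xx' rr; rewrite /surplus !lerD//; apply: ler_sumv.
- exact: t_power_mono.
- exact: s_power_mono.
- exact: r_power_mono.
- by move=> i j; rewrite !mxE.
Qed.

Lemma continuous_surplus w x : lemx (pr_min G) (w_renewable w) ->
  in_box (x_min G) (x_max G) x -> continuous (surplus w x).
Proof.
move=> pw bx rho; have ct : continuous (fun rho => sumv (t_power rho)).
  apply: continuous_sumv => i; under eq_fun do rewrite !mxE.
  case: (dt i 0); last by move=> ?; exact: cvg_cst.
  exact/continuous_sat_affine/pt_min_le_max.
have cs : continuous (fun rho => sumv (s_power x rho)).
  apply: continuous_sumv => i; under eq_fun do
    rewrite mxE [X in sat _ X _]mxE [X in sat _ (_ + X) _]mxE.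
  exact/continuous_sat_affine/ps_bar_le.
have cr : continuous (fun rho => sumv (r_power w rho)).
  apply: continuous_sumv => i; under eq_fun do
    rewrite mxE [X in sat _ X _]mxE [X in sat _ (_ + X) _]mxE.
  exact/continuous_sat_affine/pw.
by do 3 (apply: cvgD; last by [apply: cs|apply: cr|exact: cvg_cst]); exact: ct.
Qed.
Lemma next_energy_anti x rho rho' : in_box (x_min G) (x_max G) x ->
  rho <= rho' -> lemx (next_energy x rho') (next_energy x rho).
Proof.
move=> bx rr i j; have := s_power_mono bx bx (fun i j => lexx _) rr i j.
by rewrite !mxE => ?; rewrite lerD2l lerN2 ler_pM2l ?Ts_gt0.
Qed.

(** Going from [x] to [x'] raises the storage power by at most [(x' - x) / Ts]:
    both saturation bounds rise by at most that amount, and shifting all three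
    arguments of [sat] shifts its value. *)
Lemma next_energy_mono x x' rho :
  in_box (x_min G) (x_max G) x -> in_box (x_min G) (x_max G) x' ->
  lemx x x' -> lemx (next_energy x rho) (next_energy x' rho).
Proof.
move=> bx bx' xx' i j.
have := ps_bar_le bx' i j; have T0 := Ts_gt0 G; have := ps_bar_le bx i j.
rewrite !mxE; set a := Num.max _ _; set b := Num.min _ _.
set a' := Num.max _ _; set b' := Num.min _ _; set z := (_ + rho * _) => ab ab'.
pose d := (Ts G)^-1 * (x' i j - x i j).
have d0 : 0 <= d by rewrite pmulr_rge0 ?invr_gt0// subr_ge0.
have shift c : (Ts G)^-1 * (x' i j - c) = (Ts G)^-1 * (x i j - c) + d.
  by rewrite -mulrDr; congr (_ * _); lra.
have aa : a' <= a + d.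
  by rewrite /a' shift /a addr_maxl le_max2// ler_wpDr.
have bb : b' <= b + d.
  by rewrite /b' /b shift addr_minl le_min2// ler_wpDr.
have : sat a' z b' <= sat a z b + d.
  by rewrite -sat_shift; apply: sat_mono => //; rewrite ?lerD2r// ler_wpDr.
rewrite -(ler_pM2l T0) mulrDr /d mulrA mulfV ?gt_eqF// mul1r; lra.
Qed.

(** This is the purpose of the energy-dependent power bounds: their second terms
    are the powers that reach the energy limits within one sampling time. *)
Lemma next_energy_in_box x rho : in_box (x_min G) (x_max G) x ->
  in_box (x_min G) (x_max G) (next_energy x rho).
Proof.
move=> bx; have T0 := Ts_gt0 G; split=> i j; rewrite !mxE;
  have /(_ _)/andP := sat_itv _ (ps_bar_le bx i j);
  move=> /(_ ((s_part u + rho *: chi_s G) i j)); rewrite !mxE;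
  set s := sat _ _ _ => -[].
  move=> _; rewrite le_min => /andP[_]; rewrite -(ler_pM2l T0) mulrA.
  by rewrite mulfV ?gt_eqF// mul1r; lra.
rewrite ge_max => /andP[_]; rewrite -(ler_pM2l T0) mulrA.
by rewrite mulfV ?gt_eqF// mul1r; lra.
Qed.

(** The induction step of the sandwich argument. *)
Lemma step_sandwich wl w wh xl x xh rl rh :
  lemx (pr_min G) (w_renewable wl) -> lemx wl w -> lemx w wh ->
  in_box (x_min G) (x_max G) xl -> in_box (x_min G) (x_max G) xh ->
  lemx xl x -> lemx x xh -> surplus wl xl rl = 0 -> surplus wh xh rh = 0 ->
  exists rho, [/\ surplus w x rho = 0,
    lemx (next_energy xl rl) (next_energy x rho) &
    lemx (next_energy x rho) (next_energy xh rh)].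
Proof.
move=> pl lw wh' bl bh lx xh' Sl Sh; have bx := in_box_sandwich bl bh lx xh'.
have pw : lemx (pr_min G) (w_renewable w).
  by move=> i j; apply: le_trans (pl i j) _; rewrite !mxE.
have Sxl : 0 <= surplus w x rl by rewrite -Sl surplus_mono.
have Sxh : surplus w x rh <= 0 by rewrite -Sh surplus_mono.
have lo := next_energy_mono rl bl bx lx; have hi := next_energy_mono rh bx bh xh'.
have [rlh|/ltW rhl] := leP rl rh.
  (* The surplus at w and x is nonnegative at rl and nonpositive at rh, so it
     is zero on the whole interval and no storage power changes there. *)
  exists rl.
  have flat : surplus w x rl = 0 /\ surplus w x rh = 0.
    by have := surplus_mono pw bx bx (fun i j => lexx _) (fun i j => lexx _) rlh; lra.
  have sE : s_power x rl = s_power x rh.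
    apply: lemx_sumv_eq; first exact: s_power_mono.
    have := ler_sumv (t_power_mono rlh).
    have := ler_sumv (r_power_mono pw (fun i j => lexx _) rlh).
    by move: flat; rewrite /surplus; lra.
  split; [exact: flat.1|exact: lo|].
  by rewrite {1}/next_energy sE.
have [||rho] := @IVT R (surplus w x) rh rl 0 rhl.
  exact/continuous_subspaceT/continuous_surplus.
  by rewrite ge_min Sxh le_max Sxl orbT.
rewrite in_itv/= => /andP[r1 r2] S0; exists rho; split=> //.
  exact: lemx_trans lo (next_energy_anti bx r2).
exact: lemx_trans (next_energy_anti bx r1) hi.
Qed.
End Step.

(** * Trajectories *)

(** A finite-horizon, time-dependent form of dependent choice along an
    invariant. *)
Lemma exists_run (X : Type) n (Inv : nat -> X -> Prop)
    (step : 'I_n -> X -> X -> Prop) (x0 : X) : Inv 0 x0 ->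
  (forall (j : 'I_n) x, Inv j x -> exists2 x', step j x x' & Inv j.+1 x') ->
  exists2 s : nat -> X, s 0 = x0 & forall j : 'I_n, step j (s j) (s j.+1).
Proof.
move=> I0 IS.
have /choice[f fP] : forall jx : nat * X, exists x', forall lt_jn : (jx.1 < n)%N,
    Inv jx.1 jx.2 -> step (Ordinal lt_jn) jx.2 x' /\ Inv jx.1.+1 x'.
  move=> [j x]/=; have [[ltjn Ix]|no] := pselect ((j < n)%N /\ Inv j x).
    have [x' st Ix'] := IS (Ordinal ltjn) x Ix; exists x' => lt' _.
    by rewrite (bool_irrelevance lt' ltjn).
  by exists x => ltjn Ix; case: no.
pose s := fix s j := if j is i.+1 then f (i, s i) else x0.
have sI j : (j <= n)%N -> Inv j (s j).
  elim: j => // j IH ltjn; exact: (fP (j, s j) ltjn (IH (ltnW ltjn))).2.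
exists s => // -[j ltjn].
exact: (fP (j, s j) ltjn (sI _ (ltnW ltjn))).1.
Qed.

Section Feasible.
Context {R : realType} {nT nS nR nD Np : nat}.
Variables (G : microgrid R nT nS nR) (x0 : 'cV[R]_nS) (dt0 : 'cV[bool]_nT).
Variable c : control R nT nS nR Np.
Implicit Types w : 'M[R]_(nR + nD, Np).

Definition transition w (j : 'I_Np) (x x' : 'cV[R]_nS) : Prop :=
  exists2 rho, surplus G (col j c.1) (col j c.2) (col j w) x rho = 0 &
    x' = next_energy G (col j c.2) x rho.

(** Matrices are replaced by a sequence of energies, indexed by [nat] so that
    consecutive times need no casts between ordinals; only the entries up to
    [Np] matter. *)
Lemma feasibleP w : feasible G x0 dt0 c w <->
  exists2 X : nat -> 'cV[R]_nS, X 0%N = x0 &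
    forall j : 'I_Np, transition w j (X j) (X j.+1).
Proof.
have dtE j : col (rshift 1 j) (row_mx dt0 c.1) = col j c.1.
  by apply/matrixP => i k; rewrite !mxE (unsplitK (inr _ j)).
split.
  move=> [p [x [rho run]]]; exists (fun j => col (inord j) (row_mx x0 x)).
    apply/matrixP => i k; rewrite ord1 mxE.
    have -> : inord 0 = lshift Np ord0 :> 'I_(1 + Np).
      by apply: val_inj; rewrite /= inordK.
    exact: row_mxEl.
  move=> j; have := run j; rewrite dtE => run_j.
  have -> : inord j = widen_ord (leqnSn Np) j.
    by apply: val_inj; rewrite /= inordK// ltnS ltnW.
  have -> : inord j.+1 = rshift 1 j by apply: val_inj; rewrite /= inordK// ltnS.
  have [S0 ->] := (saturated_stepP _ _ _ _ _ _ _).1 (ex_intro (fun p => saturated_step _ _ _ _ p _ _ _) _ run_j).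
  by exists (rho 0 j).
move=> [X X0 run].
have /choice[pr prP] : forall j : 'I_Np, exists pr,
    saturated_step G (col j c.1) (col j c.2) (col j w) pr.1 (X j) (X j.+1) pr.2.
  move=> j; have [rho S0 XE] := run j.
  have [p pP] := (saturated_stepP G (col j c.1) (col j c.2) (col j w)
    (X j) (X j.+1) rho).2 (conj S0 XE).
  by exists (p, rho).
exists (\matrix_(i, j) (pr j).1 i 0), (\matrix_(i, j) X j.+1 i 0),
  (\row_j (pr j).2) => j.
rewrite dtE; have := prP j.
set xx := row_mx _ _.
have xxE (k : 'I_(1 + Np)) : col k xx = X k.
  apply/matrixP => i k'; rewrite ord1 {k'} mxE.
  have [l ->|l ->] := split_ordP k; last by rewrite row_mxEr mxE.
  by rewrite row_mxEl ord1 X0.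
rewrite !xxE mxE /=.
by congr saturated_step; apply/matrixP => i k; rewrite ord1 !mxE.
Qed.
End Feasible.

(** The invariant of the construction: the energy stays between two feasible
    trajectories, both of which respect the energy limits. *)
Lemma feasible_between (R : realType) (nT nS nR nD Np : nat)
    (G : microgrid R nT nS nR) (wmin w wmax : 'M[R]_(nR + nD, Np))
    (x0 : 'cV[R]_nS) (dt0 : 'cV[bool]_nT) (c : control R nT nS nR Np) :
  (forall j, lemx (pr_min G) (w_renewable (col j wmin))) ->
  in_box (x_min G) (x_max G) x0 -> in_box wmin wmax w ->
  feasible G x0 dt0 c wmin -> feasible G x0 dt0 c wmax ->
  feasible G x0 dt0 c w.
Proof.
move=> pr bx0 [wl wh] /feasibleP[L L0 runL] /feasibleP[H H0 runH].
pose box := in_box (x_min G) (x_max G).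
apply/feasibleP.
apply: (exists_run (Inv := fun j x =>
  [/\ box (L j), box (H j), lemx (L j) x & lemx x (H j)])).
  by rewrite L0 H0; split.
move=> j x [bL bH Lx xH].
have [rl Sl ->] := runL j; have [rh Sh ->] := runH j.
have [rho [S0 lo hi]] := step_sandwich (pr j) (lemx_col j wl) (lemx_col j wh)
  bL bH Lx xH Sl Sh.
exists (next_energy G (col j c.2) x rho); first by exists rho.
by split=> //; exact: next_energy_in_box.
Qed.

Theorem theorem1 (R : realType) (nT nS nR nD Np : nat)
    (G : microgrid R nT nS nR)
    (wmin wmax : 'M[R]_(nR + nD, Np))
    (wmin_sign : disturbance_sign wmin)
    (wmax_sign : disturbance_sign wmax)
    (wmin_le_max : lemx wmin wmax)
    (wmin_ge_pr_min : forall j, lemx (pr_min G) (w_renewable (col j wmin)))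
    (x0 : 'cV[R]_nS) (x0_box : in_box (x_min G) (x_max G) x0)
    (dt0 : 'cV[bool]_nT) :
  [set c : control R nT nS nR Np | admissible G c /\
     forall w : 'M[R]_(nR + nD, Np), in_box wmin wmax w -> feasible G x0 dt0 c w]
  = [set c : control R nT nS nR Np | admissible G c /\
     feasible G x0 dt0 c wmin /\ feasible G x0 dt0 c wmax].
Proof.
apply/seteqP; split=> c /= [adm feas]; split=> //.
  by split; apply: feas; split=> // i j.
by case: feas => fmin fmax w boxw; exact: feasible_between fmin fmax.
Qed.
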